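(* Let $q$ be a prime power and $m>1$ an integer. Then $$\left|\Psi_I(\operatorname{TSRI}(m,2,q))\right|=\begin{cases}\dfrac{q}{2m}(q^m-1) & \text{if } q \text{ is odd and } m=2^\ell,\\[2mm] \dfrac{q}{2m}\displaystyle\sum_{d\mid m,\ d\text{ odd}}\mu(d)q^{m/d} & \text{if } q \text{ is odd and } m=2^\ell k \text{ with } k\ge 3 \text{ odd},\\[2mm] \dfrac{q-1}{2m}\displaystyle\sum_{d\mid m,\ d\text{ odd}}\mu(d)q^{m/d} & \text{otherwise},\end{cases}$$ where $\mu$ is the Möbius function.
   Context: $\operatorname{TSR}(m,n,q)$ denotes the set of $mn\times mn$ matrices $T$ over $\mathbb F_q$ which, viewed as $n\times n$ block matrices with $m\times m$ blocks, have the form: the block in position $(i+1,i)$ is $I_m$ for $i=1,\dots,n-1$; the last block column is $(c_0A, c_1A,\dots,c_{n-1}A)^{\top}$ for some $c_0,\dots,c_{n-1}\in\mathbb F_q$ and $A\in M_m(\mathbb F_q)$; all other blocks are zero. $\operatorname{TSRI}(m,n,q)$ is the set of $T\in\operatorname{TSR}(m,n,q)$ whose characteristic polynomial $\det(XI_{mn}-T)$ is irreducible over $\mathbb F_q$, and $\Psi_I(\operatorname{TSRI}(m,n,q))$ is the set of polynomials $\det(XI_{mn}-T)$ for $T\in\operatorname{TSRI}(m,n,q)$. *)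

(* Defs.v *)
From HB Require Import structures.
From mathcomp Require Import all_boot all_order all_algebra.
From mathcomp Require Import qpoly finmap.

Set Implicit Arguments.
Unset Strict Implicit.
Unset Printing Implicit Defensive.

Import GRing.Theory.
Local Open Scope ring_scope.

(* The Moebius function at positive arguments; the value at 0 is irrelevant. *)
Definition mobius (d : nat) : int :=
  if all (fun p => logn p d == 1%N) (primes d) then (-1) ^+ size (primes d)
  else 0.

Section TSR.

Variables (F : finFieldType) (m n : nat).

(* Indices start at 0, so the last block column is the j with j.+1 == n.
   The size \sum_(i < n) m, equal to n * m, is the one \mxblock yields for
   n x n blocks of size m x m. *)
Definition tsr_mx (c : {ffun 'I_n -> F}) (A : 'M[F]_m) :
    'M[F]_(\sum_(i < n) m) :=
  \mxblock_(i < n, j < n)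
    (if j.+1 == n :> nat then c i *: A
     else if i == j.+1 :> nat then 1%:M
     else 0).

Definition TSR : {set 'M[F]_(\sum_(i < n) m)} :=
  [set tsr_mx c A | c : {ffun 'I_n -> F}, A : 'M[F]_m].

Definition TSRI : {set 'M[F]_(\sum_(i < n) m)} :=
  [set T in TSR | irreducibleb (char_poly T)].

Lemma TSRIP (T : 'M[F]_(\sum_(i < n) m)) :
  T \in TSRI <-> T \in TSR /\ irreducible_poly (char_poly T).
Proof.
rewrite inE; split=> [/andP[-> /irreducibleP]|[-> /irreducibleP]] //.
Qed.

End TSR.

Arguments TSR F m n : clear implicits.
Arguments TSRI F m n : clear implicits.

Definition PsiI (F : finFieldType) (k : nat) (S : {set 'M[F]_k}) :
    {fset {poly F}} :=
  [fset char_poly T | T in S]%fset.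

(* Main.v *)
Require Import Defs.
From HB Require Import structures.
From mathcomp Require Import all_boot all_order all_algebra all_field.
From mathcomp Require Import qpoly finmap.
From mathcomp Require Import ring.

(* Let [phi] be the Frobenius [x |-> x ^ q] on an extension [L] of [F] in which
   [X ^ (q ^ 2m) - X] splits.  For [T] with last block column [c0 A, c1 A],
   [b] is an eigenvalue of [T] iff [(c0 + c1 b) v A = b ^ 2 v] for some
   [v != 0].  Hence a root [b] of an irreducible characteristic polynomial
   satisfies a quadratic equation [X ^ 2 = al (c0 + c1 X)] with [al] an
   eigenvalue of [A]; comparing degrees, [b] and [phi^m b] are its two roots, so
   that [1 / b + 1 / phi^m b = - c1 / c0] lies in [F].  Conversely this condition
   produces [A] and [T].  The polynomials thus correspond to the [phi]-orbits of
   size [2 m] of the [b] with [1 / b + 1 / phi^m b] in [F].  Such [b] are the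
   [1 / (a + x)] with [phi^m x = - x] for odd [q], and the [1 / (a x)] with
   [a != 0], [phi^m x = 1 - x] for even [q].  Without the condition on the orbit
   size there are [q ^ m] solutions [x]; Moebius inversion over the odd divisors
   of [m] isolates the orbits of size exactly [2 m]. *)

Set Implicit Arguments.
Unset Strict Implicit.
Unset Printing Implicit Defensive.

Import GRing.Theory.
Local Open Scope ring_scope.

(** * The Moebius function and its divisor sums *)

Lemma mobius_sq (p d : nat) : (0 < d)%N -> prime p -> (p * p %| d)%N ->
  mobius d = 0.
Proof.
move=> d0 pp pd; rewrite /mobius.
case: ifPn => // /allP/(_ p); rewrite mem_primes pp d0.
rewrite (dvdn_trans (dvdn_mulr p (dvdnn p)) pd) => /(_ isT)/eqP l1.
by move: pd; rewrite mulnn pfactor_dvdn // l1.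
Qed.

Lemma mobiusM_prime (p d : nat) : (0 < d)%N -> prime p -> ~~ (p %| d)%N ->
  mobius (p * d) = - mobius d.
Proof.
move=> d0 pp pd; have p0 := prime_gt0 pp.
have pr : perm_eq (primes (p * d)) (p :: primes d).
  apply: uniq_perm; rewrite ?primes_uniq //=.
    by rewrite primes_uniq andbT mem_primes pp d0.
  by move=> x; rewrite primesM // inE primes_prime // inE.
rewrite /mobius (perm_all _ pr) (perm_size pr) /= exprS mulN1r.
rewrite lognM // logn_prime // eqxx (_ : logn p d = 0)%N; last first.
  by apply/eqP; rewrite -leqn0 leqNgt logn_gt0 mem_primes pp d0.
rewrite addn0 eqxx /=.
have -> : all (fun r => logn r (p * d) == 1)%N (primes d) =
          all (fun r => logn r d == 1)%N (primes d).
  apply: eq_in_all => r; rewrite mem_primes => /and3P[rp _ rd].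
  rewrite lognM // logn_prime //; have [e|] := eqVneq r p; last by rewrite add0n.
  by rewrite -e rd in pd.
by case: ifP; rewrite ?oppr0.
Qed.

(** Let [p] be a prime factor of [n]. Divisors that are multiples of [p * p] contribute 0, and
    [d |-> p * d] matches the divisors prime to [p] with the remaining ones, reversing the sign. *)
Lemma sum_mobius_divisors (n : nat) : (0 < n)%N ->
  \sum_(d <- divisors n) mobius d = (n == 1)%:R.
Proof.
move=> n0; case: eqP => [->|/eqP n1].
  by rewrite (_ : divisors 1 = [:: 1%N]) // big_seq1.
set p := pdiv n; have pp : prime p by rewrite pdiv_prime // ltn_neqAle eq_sym n1.
have p0 := prime_gt0 pp.
have dn x : (x \in divisors n) = (x %| n)%N by rewrite dvdn_divisors.
rewrite (bigID (fun d => p %| d)%N) /= [X in X + _](bigID (fun d => p * p %| d)%N) /=.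
rewrite big_seq_cond big1 ?add0r; last first.
  move=> d /andP[]; rewrite dn => /(dvdn_gt0 n0) d0 /andP[_]; exact: mobius_sq.
rewrite -!(big_filter (divisors n)).
have pe : perm_eq [seq d <- divisors n | (p %| d)%N && ~~ (p * p %| d)%N]
            [seq p * d | d <- [seq d <- divisors n | ~~ (p %| d)%N]]%N.
  apply: uniq_perm; rewrite ?filter_uniq ?divisors_uniq //.
    rewrite map_inj_in_uniq ?filter_uniq ?divisors_uniq //.
    by move=> x y _ _ /eqP; rewrite eqn_pmul2l // => /eqP.
  move=> x; rewrite mem_filter dn; apply/idP/mapP => [/andP[/andP[px ppx] xn]|].
    exists (x %/ p)%N; last by rewrite mulnC divnK.
    rewrite mem_filter dn -(@dvdn_pmul2l p p) // (mulnC p (x %/ p)%N) divnK // ppx.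
    by rewrite dvdn_divLR // dvdn_mulr.
  case=> y; rewrite mem_filter dn => /andP[py yn] ->.
  rewrite dvdn_mulr //= dvdn_pmul2l // py /= Gauss_dvd.
    by rewrite pdiv_dvd.
  by rewrite prime_coprime.
rewrite (perm_big _ pe) big_map big_filter big_filter.
rewrite (_ : \sum_(i <- divisors n | ~~ (p %| i)%N) mobius (p * i) =
  - \sum_(i <- divisors n | ~~ (p %| i)%N) mobius i) ?addNr //.
rewrite -sumrN big_seq_cond [RHS]big_seq_cond; apply: eq_bigr => d /andP[].
by rewrite dn => /(dvdn_gt0 n0) d0; apply: mobiusM_prime.
Qed.

(** * Moebius inversion over orbit sizes *)

Lemma iter_eq_order (T : finType) (f : T -> T) (x : T) (k : nat) :
  injective f -> (iter k f x == x) = (order f x %| k)%N.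
Proof.
move=> fI; set r := order f x.
have r0 : (0 < r)%N := order_gt0 f x.
have E : iter k f x = iter (k %% r) f x.
  rewrite {1}(divn_eq k r) addnC iterD; congr iter.
  by elim: (k %/ r)%N => // j IH; rewrite mulSn iterD IH iter_order.
rewrite E; apply/eqP/eqP => [e|->//].
by rewrite -(findex_iter (ltn_pmod k r0)) e findex0.
Qed.

(* Every [x] occurring on the right has order [2 m / t] with [t] odd, and it
   occurs exactly in the terms with [d %| t], whose weights add up to [t == 1]. *)
Lemma card_order_twice_mobius (T : finType) (f tau : T -> T) (m : nat) :
    injective f -> involutive tau -> (forall x, f (tau x) = tau (f x)) ->
    (0 < m)%N ->
  #|[set x | (iter m f x == tau x) && (order f x == m.*2)]|%:Z =
  \sum_(d <- divisors m | odd d)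
    mobius d * #|[set x | (iter (m %/ d) f x == tau x) && (tau x != x)]|%:Z.
Proof.
move=> fI tauK ftau m0.
have iterT k x : iter k f (tau x) = tau (iter k f x).
  by elim: k => //= k ->.
have iter2 k x : iter k f x = tau x -> iter k.*2 f x = x.
  by move=> e; rewrite -addnn iterD e iterT e tauK.
have iterO j k x : odd j -> iter k f x = tau x -> iter (k * j) f x = tau x.
  move=> oj e; rewrite -(odd_double_half j) oj mulnDr muln1 iterD -muln2.
  rewrite mulnCA (_ : iter _ f x = x) //.
  by apply/eqP; rewrite iter_eq_order // dvdn_mull // -iter_eq_order // muln2 iter2.
transitivity (\sum_(x | (iter m f x == tau x) && (tau x != x))
   \sum_(d <- divisors m | odd d) mobius d * (iter (m %/ d) f x == tau x)%:Z).
  (* The condition [tau x != x] comes for free: otherwise [f^m x = x], and the order [2 m] would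
     divide [m]. *)
  have -> : #|[set x | (iter m f x == tau x) && (order f x == m.*2)]|%:Z =
    \sum_(x | (iter m f x == tau x) && (tau x != x)) (order f x == m.*2)%:Z.
    rewrite -natz -sum1_card natr_sum big_mkcond [RHS]big_mkcond.
    apply: eq_bigr => x _; rewrite inE; case: eqP => //= e.
    case: eqP => o; last by case: ifP.
    rewrite -e iter_eq_order // o -[(_ %| m)%N]negbK negbK; case: ifPn => //.
    by rewrite negbK => /(dvdn_leq m0); rewrite leqNgt -addnn -{1}[m]addn0 ltn_add2l m0.
  apply: eq_bigr => x /andP[/eqP e ne].
  set r := order f x.
  have r0 : (0 < r)%N := order_gt0 f x.
  have rm : (r %| m.*2)%N by rewrite -iter_eq_order // iter2.
  have rNm : ~~ (r %| m)%N by rewrite -iter_eq_order // e.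
  pose t := (m.*2 %/ r)%N.
  have tr : (t * r = m.*2)%N by rewrite divnK.
  have t0 : (0 < t)%N by case: (t) tr => //; rewrite mul0n; case: (m) m0.
  have ot : odd t.
    (* For even [t], the equation [t * r = 2 m] halves to [(t / 2) * r = m], contradicting [rNm]. *)
    apply: contraR rNm => et; apply/dvdnP; exists t./2.
    by apply: double_inj; rewrite -tr -mul2n mulnA mul2n even_halfK.
  have tm : (t %| m)%N.
    by rewrite -(@Gauss_dvdr _ 2) ?coprimen2 // mul2n -tr dvdn_mulr.
  (* If [f^(m/d) x = tau x] then [r] divides [2 m / d], so [d] divides [t]. Conversely, if [d]
     divides [t] then [f^(2m/d)] fixes [x], and since [d] is odd, [f^m] and [f^(m/d)] agree at
     [x]. *)
  have key d : (d \in divisors m) && odd d && (iter (m %/ d) f x == tau x)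
             = (d \in divisors t).
    rewrite -!dvdn_divisors //; apply/idP/idP => [/andP[/andP[dm od] /eqP ed]|dt].
      have d0 := dvdn_gt0 m0 dm.
      have : (r %| (m %/ d).*2)%N by rewrite -iter_eq_order // iter2.
      case/dvdnP=> s es; apply/dvdnP; exists s; apply/eqP.
      rewrite -(eqn_pmul2r r0) tr -{1}(divnK dm) -muln2 mulnAC muln2 es.
      by rewrite mulnAC.
    have dm := dvdn_trans dt tm; have od := dvdn_odd dt ot.
    rewrite dm od /=; have d0 := dvdn_gt0 m0 dm.
    have h : iter (m %/ d).*2 f x = x.
      apply/eqP; rewrite iter_eq_order //; apply/dvdnP; exists (t %/ d)%N.
      apply/eqP; rewrite -(eqn_pmul2r d0) -muln2 mulnAC divnK // muln2 -tr.
      by rewrite mulnAC divnK.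
    rewrite -e -{2}(divnK dm) -{3}(odd_double_half d) od /= mulnDr muln1 iterD.
    rewrite (_ : iter (_ * _) f x = x) // -muln2 mulnCA.
    by apply/eqP; rewrite iter_eq_order // dvdn_mull // -iter_eq_order // muln2 h.
  have -> : (r == m.*2) = (t == 1)%N.
    rewrite -tr; apply/eqP/eqP => [/eqP|->]; last by rewrite mul1n.
    by rewrite eq_sym -{2}[r]mul1n eqn_pmul2r // => /eqP.
  rewrite -natz -sum_mobius_divisors //.
  have pe : perm_eq (divisors t)
      [seq d <- divisors m | odd d && (iter (m %/ d) f x == tau x)].
    apply: uniq_perm; rewrite ?filter_uniq ?divisors_uniq // => d.
    by rewrite mem_filter -key [RHS]andbC andbA.
  rewrite (perm_big _ pe) big_filter big_mkcondr /=.
  by apply: eq_bigr => d _; case: ifP; rewrite ?mulr1 ?mulr0.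
rewrite exchange_big /= big_seq_cond [RHS]big_seq_cond; apply: eq_bigr => d.
rewrite -dvdn_divisors // => /andP[dm od]; rewrite -mulr_sumr; congr (_ * _).
rewrite -natz -sum1_card natr_sum big_mkcond [RHS]big_mkcond.
apply: eq_bigr => x _; rewrite inE; case: (tau x =P x) => _; rewrite ?andbF //= !andbT.
case: eqP => [e|ne]; case: eqP => [e'|_] //.
by case: ne; rewrite -{1}(divnK dm) iterO.
Qed.

(** * The relative Frobenius, descent to [F] and minimal polynomials *)

Lemma card_finField_pnat (F : finFieldType) : [pchar F].-nat #|F|.
Proof.
have [p pp pF] := finPcharP F; rewrite (eq_pnat _ (pcharf_eq pF)).
by rewrite (card_pprimeChar pF) pnatX pnat_id.
Qed.

(* The embedding is a phantom argument, on which the morphism instance is keyed. *)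
Definition frob (F L : finFieldType) of {rmorphism F -> L} :=
  fun x : L => x ^+ #|F|.

Section Frobenius.

Variables (F L : finFieldType) (iota : {rmorphism F -> L}).
Local Notation phi := (frob iota).
Local Notation "p ^i" := (map_poly iota p) (at level 2, format "p ^i").

Fact frob_is_zmod_morphism : zmod_morphism phi.
Proof.
have phiD x y : phi (x + y) = phi x + phi y.
  rewrite /frob exprDn_pchar // (eq_pnat _ (fmorph_pchar iota)).
  exact: card_finField_pnat.
by move=> x y; apply: (addIr (phi y)); rewrite -phiD !subrK.
Qed.

Fact frob_is_monoid_morphism : monoid_morphism phi.
Proof. by split=> [|x y]; rewrite /frob ?expr1n ?exprMn. Qed.

HB.instance Definition _ :=
  GRing.isZmodMorphism.Build L L phi frob_is_zmod_morphism.
HB.instance Definition _ :=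
  GRing.isMonoidMorphism.Build L L phi frob_is_monoid_morphism.

Lemma frob_inj : injective phi. Proof. exact: fmorph_inj. Qed.

Lemma iter_frob k x : iter k phi x = x ^+ (#|F| ^ k).
Proof. by elim: k => //= k ->; rewrite /frob expnSr exprM. Qed.

Lemma frob_iota a : phi (iota a) = iota a.
Proof. by rewrite /frob -rmorphXn expf_card. Qed.

(** A fixed point is a root of [X^#|F| - X], which already splits over [F] into the factors
    [X - a]. *)
Lemma frob_fixed x : phi x = x -> exists a, x = iota a.
Proof.
move=> fx; have: root ('X^#|F| - 'X)^i x.
  by rewrite rmorphB /= map_polyXn map_polyX rootE !hornerE [x ^+ _]fx subrr.
have -> : ('X^#|F| - 'X)^i = \prod_(z <- [seq iota a | a : F]) ('X - z%:P).
  rewrite finField_genPoly rmorph_prod big_image /=; apply: eq_bigr => a _.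
  by rewrite rmorphB /= map_polyX map_polyC.
by rewrite root_prod_XsubC => /mapP[a _ ->]; exists a.
Qed.

Lemma frob_fixed_poly (p : {poly L}) : map_poly phi p = p -> exists P, P^i = p.
Proof.
move=> fp; exists (\poly_(i < size p) odflt 0 [pick a | iota a == p`_i]).
apply/polyP=> i; rewrite coef_map coef_poly.
case: ltnP => [_|si]; last by rewrite [RHS]nth_default //; exact: rmorph0.
case: pickP => [a /eqP //|/= no].
have [|a Ea] := @frob_fixed p`_i; first by rewrite -{2}fp coef_map.
by have := no a; rewrite Ea eqxx.
Qed.

Lemma perm_frob_orbit x : perm_eq (map phi (orbit phi x)) (orbit phi x).
Proof.
apply: uniq_perm; rewrite ?map_inj_uniq ?orbit_uniq //; try exact: frob_inj.
have un : uniq (map phi (orbit phi x)).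
  by rewrite map_inj_uniq ?orbit_uniq //; exact: frob_inj.
apply: (uniq_min_size un _ _).2; last by rewrite size_map.
by move=> _ /mapP[y yx ->]; exact: mem_orbit.
Qed.

Lemma root_frob (P : {poly F}) x : root P^i x -> root P^i (phi x).
Proof.
move=> /eqP r; rewrite rootE -(_ : map_poly phi P^i = P^i) ?horner_map /= ?r ?rmorph0 //.
by rewrite -map_poly_comp; apply: eq_map_poly => a /=; exact: frob_iota.
Qed.

Lemma root_iter_frob (P : {poly F}) x k :
  root P^i x -> root P^i (iter k phi x).
Proof. by move=> r; elim: k => //= k; exact: root_frob. Qed.

(** The product of the [X - y] over the orbit of [x] is invariant under [phi], so it descends to
    [F]. A nonconstant divisor over [F] has a root in the orbit, hence the whole orbit as roots. *)
Lemma minimal_poly_frob x : exists P : {poly F},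
  [/\ P \is monic, irreducible_poly P, size P = (order phi x).+1 & root P^i x].
Proof.
set R := \prod_(y <- orbit phi x) ('X - y%:P).
have [|P PR] := @frob_fixed_poly R.
  rewrite /R rmorph_prod /= -[RHS](perm_big _ (perm_frob_orbit x)) big_map.
  by apply: eq_bigr => y _; rewrite rmorphB /= map_polyX map_polyC.
have sP : size P = (order phi x).+1.
  by rewrite -(size_map_poly iota) PR size_prod_XsubC size_orbit.
have rP : root P^i x by rewrite PR root_prod_XsubC in_orbit.
exists P; split=> //.
  by rewrite -(map_monic iota) PR monic_prod_XsubC.
split=> [|Q sQ QP]; first by rewrite sP ltnS order_gt0.
have P0 : P != 0 by rewrite -size_poly_eq0 sP.
have Q0 := dvdpN0 QP P0.
rewrite /eqp QP /= -(dvdp_map iota) PR.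
have := QP; rewrite -(dvdp_map iota) PR => /dvdp_prod_XsubC[msk].
set s := mask _ _ => Es.
have [y ys] : exists y, y \in s.
  case Ds: s Es => [|y s']; last by exists y; rewrite mem_head.
  rewrite big_nil => /eqp_size; rewrite size_map_poly size_poly1 => e.
  by rewrite e in sQ.
have yx := mem_mask ys; rewrite -fconnect_orbit in yx.
have ry : root Q^i y by rewrite (eqp_root Es) root_prod_XsubC.
rewrite fconnect_sym in yx; last exact: frob_inj.
apply: uniq_roots_dvdp; last by rewrite uniq_rootsE orbit_uniq.
apply/allP=> z; rewrite -fconnect_orbit => xz.
by rewrite -(iter_findex (connect_trans yx xz)); exact: root_iter_frob.
Qed.

(** If [P] did not divide [Q], the two would be coprime over [F], hence also over [K], where they
    could not share a root. *)
Lemma irreducible_dvd_common_root (K : fieldType) (j : {rmorphism F -> K})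
    (P Q : {poly F}) x :
  irreducible_poly P -> root (map_poly j P) x -> root (map_poly j Q) x ->
  P %| Q.
Proof.
move=> Pi Px Qx; apply: contraLR Qx.
rewrite -(irreducible_poly_coprime _ Pi) -(coprimep_map j) => c.
exact: coprimep_root c Px.
Qed.

Lemma size_irreducible_root (P : {poly F}) x :
  irreducible_poly P -> root P^i x -> size P = (order phi x).+1.
Proof.
move=> Pi Px; have [Q [_ Qi <- Qx]] := minimal_poly_frob x.
apply: eqp_size; apply/andP.
by split; [exact: irreducible_dvd_common_root Pi Px Qx
          |exact: irreducible_dvd_common_root Qi Qx Px].
Qed.

Lemma order_frob_dvd_root (P : {poly F}) x :
  P != 0 -> root P^i x -> (order phi x < size P)%N.
Proof.
move=> P0 Px; have [Q [_ Qi <- Qx]] := minimal_poly_frob x.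
by apply: dvdp_leq => //; apply: irreducible_dvd_common_root Qi Qx Px.
Qed.

End Frobenius.

(** * Irreducible polynomials as divisors of [X^(q^n) - X], and its splitting field *)

(** Adjoining a root [z] of [P] gives a field with [#|F| ^ deg P] elements, in which [z] satisfies
    Fermat's equation. *)
Lemma irreducible_dvd_Xq (F : finFieldType) (P : {poly F}) :
  irreducible_poly P -> P %| 'X^(#|F| ^ (size P).-1) - 'X.
Proof.
move=> Pi; have [K dK [z rz _]] := irredp_FAdjoin Pi.
apply: (irreducible_dvd_common_root (j := in_alg K) Pi rz).
rewrite rmorphB /= map_polyXn map_polyX rootE !hornerE subr_eq0 -dK.
by rewrite -(Fermat's_little_theorem {:K}%AS) memvf.
Qed.

(** The roots are distinct because [q^n = 0] in [L], which makes the derivative the constant -1. *)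
Lemma exists_splitting_Xq (F : finFieldType) (n : nat) : (0 < n)%N ->
  exists (L : finFieldType) (iota : {rmorphism F -> L}) (s : seq L),
    uniq s /\ 'X^(#|F| ^ n) - 'X = \prod_(z <- s) ('X - z%:P).
Proof.
move=> n0; set Q := (#|F| ^ n)%N.
have Q1 : (1 < Q)%N by rewrite -(exp1n n) ltn_exp2r // finNzRing_gt1.
have mon (R : nzRingType) : 'X^Q - 'X \is @monic R.
  by rewrite monicE lead_coefDl ?lead_coefXn // size_polyN size_polyX size_polyXn.
have /FinSplittingFieldFor[L [s]] : 'X^Q - 'X != 0 :> {poly F}.
  exact: monic_neq0 (mon F).
rewrite rmorphB /= map_polyXn map_polyX => Es _.
have {Es}E : 'X^Q - 'X = \prod_(z <- s) ('X - z%:P).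
  by apply/eqP; rewrite -(eqp_monic (mon L) (monic_prod_XsubC _ _ _)).
exists (finvect_type L), (in_alg (finvect_type L)), s; split=> //.
rewrite -separable_prod_XsubC -E unlock.
rewrite derivB derivXn derivX.
have -> : 'X^(Q.-1) *+ Q = 0 :> {poly L}.
  have [p pp pF] := finPcharP F.
  have p0 : p%:R = 0 :> L by apply: pcharf0; rewrite pchar_lalg.
  have := finNzRing_gt1 F; rewrite -mulr_natr -polyC_natr /Q natrX.
  rewrite (card_pprimeChar pF) natrX p0.
  by case: (logn _ _) => // k _; rewrite expr0n /= expr0n -(prednK n0) mulr0.
by rewrite sub0r -[X in coprimep _ X]scaleN1r coprimepZr ?coprimep1 // oppr_eq0 oner_eq0.
Qed.

(** * Eigenvalues of [T] for two blocks *)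

(** Since [(u, w) T = (w, (c0 u + c1 w) A)], an eigenvector for [b] must be [(v, b v)], and only the
    equation of the second block remains. *)
Lemma eigenvalue_tsr2 (F : finFieldType) (m : nat) (c : {ffun 'I_2 -> F})
    (A : 'M[F]_m) (b : F) :
  eigenvalue (tsr_mx c A) b <->
  exists2 v : 'rV[F]_m, (c 0 + c 1 * b) *: (v *m A) = b ^+ 2 *: v & v != 0.
Proof.
have mulT (w : forall j : 'I_2, 'rV[F]_m) :
    \mxrow_j w j *m tsr_mx c A
      = \mxrow_j (if j == 0 then w 1 else (c 0 *: w 0 + c 1 *: w 1) *m A).
  rewrite /tsr_mx mul_mxrow_mxblock; apply: eq_mxrow => j.
  rewrite !big_ord_recl big_ord0 addr0.
  case: j => [[|[|j]] //= jlt].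
    by rewrite mulmx0 add0r mulmx1; congr w; apply: val_inj.
  rewrite -!scalemxAr mulmxDl -!scalemxAl.
  by congr (c _ *: (w _ *m A) + c _ *: (w _ *m A)); apply: val_inj.
have scl (w : forall j : 'I_2, 'rV[F]_m) :
    b *: \mxrow_j w j = \mxrow_j (b *: w j).
  by apply/matrixP => i j; rewrite !mxE.
split=> [/eigenvalueP[w]|[v Ev v0]].
  rewrite -(submxrowK w); set u := submxrow w; rewrite mulT scl.
  move/eq_mxrowP => E w0; have /= E0 := E 0; have /= E1 := E 1.
  exists (u 0); last first.
    apply: contraNneq w0 => u0; apply/eqP; rewrite -[RHS]mxrow0.
    apply: eq_mxrow => -[[|[|j]] //= jlt].
      by rewrite -[RHS]u0; congr u; apply: val_inj.
    rewrite (_ : Ordinal _ = 1) ?E0 ?u0 ?scaler0 //; exact: val_inj.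
  rewrite E0 in E1; rewrite expr2 -scalerA -E1 mulmxDl -!scalemxAl.
  by rewrite scalerA -scalerDl.
apply/eigenvalueP; exists (\mxrow_(j < 2) (if j == 0 then v else b *: v)).
  rewrite (mulT (fun j => if j == 0 then v else b *: v)) scl.
  apply: eq_mxrow => -[[|[|j]] //= jlt].
  by rewrite scalerA -scalerDl -scalemxAl Ev scalerA.
apply: contraNneq v0 => E.
have := congr1 (fun w => submxrow w 0) E.
by rewrite mxrowK submxrow0 /= => ->.
Qed.

Lemma root_char_poly_tsr2 (F L : finFieldType) (iota : {rmorphism F -> L})
    (m : nat) (c : {ffun 'I_2 -> F}) (A : 'M[F]_m) (b : L) :
  root (map_poly iota (char_poly (tsr_mx c A))) b <->
  exists2 v : 'rV[L]_m, (iota (c 0) + iota (c 1) * b) *: (v *m map_mx iota A)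
     = b ^+ 2 *: v & v != 0.
Proof.
rewrite map_char_poly -eigenvalue_root_char.
rewrite (_ : map_mx iota _ = tsr_mx [ffun i => iota (c i)] (map_mx iota A)).
  by rewrite eigenvalue_tsr2 !ffunE.
rewrite /tsr_mx; apply/matrixP => i j; rewrite !mxE.
case: ifP => _; first by rewrite !mxE ffunE rmorphM.
by case: ifP => _; rewrite !mxE ?rmorph0 // rmorph_nat.
Qed.

Lemma exists_char_poly (F : fieldType) (m : nat) (f : {poly F}) :
  f \is monic -> size f = m.+1 -> exists A : 'M[F]_m, char_poly A = f.
Proof.
move=> fm fs; have em : m = (size f).-1 by rewrite fs.
by rewrite em; exists (companionmx f); exact: companionmxK.
Qed.

(** * Which elements are roots of polynomials in [PsiI (TSRI F m 2)] *)

Section RootCriterion.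

Variables (F L : finFieldType) (iota : {rmorphism F -> L}) (m : nat).
Hypothesis m_gt1 : (1 < m)%N.
Local Notation phi := (frob iota).

Lemma order_frob_gt1_neq0 (b : L) : (1 < order phi b)%N -> b != 0.
Proof.
apply: contraTneq => ->; rewrite -leqNgt dvdn_leq //.
by rewrite -(iter_eq_order _ _ (@frob_inj _ _ iota)) /= rmorph0.
Qed.

(** With [k] the order of [al], the map [phi^k] preserves the quadratic equation [quad] of [x], so
    it permutes its roots. As [k <= m] and [x] has order [2 m], it swaps two distinct roots and
    [k = m]; Vieta's formulas then give [- c1 / c0]. *)
Lemma tsr2_root_inv_trace (c : {ffun 'I_2 -> F}) (A : 'M[F]_m) (x : L) :
    order phi x = m.*2 -> root (map_poly iota (char_poly (tsr_mx c A))) x ->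
  exists a, x^-1 + (iter m phi x)^-1 = iota a.
Proof.
move=> ox /root_char_poly_tsr2[v Ev v0].
have fI := frob_inj (iota := iota).
have x0 : x != 0.
  by apply: order_frob_gt1_neq0; rewrite ox -addnn ltn_addl.
set g := _ + _ in Ev.
have g0 : g != 0.
  apply: contraNneq v0 => g0; rewrite g0 scale0r in Ev.
  by have /esym/eqP := Ev; rewrite scaler_eq0 expf_eq0 (negPf x0) andbF.
have [al Dal] : {al | al = x ^+ 2 / g} by exists (x ^+ 2 / g).
have al0 : al != 0 by rewrite Dal mulf_neq0 ?invr_eq0 // expf_neq0.
have rA : root (map_poly iota (char_poly A)) al.
  rewrite map_char_poly -eigenvalue_root_char; apply/eigenvalueP; exists v => //.
  by rewrite Dal mulrC -scalerA -Ev scalerA mulVf // scale1r.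
have quad : x ^+ 2 = al * (iota (c 0) + iota (c 1) * x).
  by rewrite Dal mulrAC -/g mulfK.
pose k := order phi al.
have km : (k <= m)%N.
  rewrite -ltnS -(size_char_poly A); apply: order_frob_dvd_root rA.
  exact: monic_neq0 (char_poly_monic A).
have k0 : (0 < k)%N := order_gt0 phi al.
have itI j : injective (iter j phi) by elim: j => // j IH y z /= /fI /IH.
have itM j y z : iter j phi (y * z) = iter j phi y * iter j phi z.
  by elim: j => //= j ->; rewrite rmorphM.
have itD j y z : iter j phi (y + z) = iter j phi y + iter j phi z.
  by elim: j => //= j ->; rewrite rmorphD.
have itF j a : iter j phi (iota a) = iota a.
  by elim: j => //= j ->; rewrite frob_iota.
have itq u : u ^+ 2 = al * (iota (c 0) + iota (c 1) * u) ->
  iter k phi u ^+ 2 = al * (iota (c 0) + iota (c 1) * iter k phi u).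
  move=> /(congr1 (iter k phi)).
  by rewrite expr2 !itM itD itM !itF -expr2 /k iter_order.
pose y := iter k phi x.
have quady : y ^+ 2 = al * (iota (c 0) + iota (c 1) * y) := itq _ quad.
pose z := iter k phi y.
have quadz : z ^+ 2 = al * (iota (c 0) + iota (c 1) * z) := itq _ quady.
have sum_roots u w : u ^+ 2 = al * (iota (c 0) + iota (c 1) * u) ->
    w ^+ 2 = al * (iota (c 0) + iota (c 1) * w) -> u != w ->
    u + w = al * iota (c 1).
  move=> Eu Ew uw; apply: (mulIf (x := u - w)); first by rewrite subr_eq0.
  by rewrite mulrC -subr_sqr Eu Ew; ring.
have xy : x != y.
  rewrite eq_sym iter_eq_order // ox; apply/negP => /(dvdn_leq k0).
  by rewrite leqNgt (leq_ltn_trans km) // -addnn -{1}[m]addn0 ltn_add2l ltnW.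
have yz : y != z by apply: contraNneq xy => /itI ->.
(* Both [x + y] and [y + z] equal the sum of the roots [al * c1]. *)
have xz : z = x.
  apply: (addrI y); rewrite (sum_roots _ _ quady quadz yz) addrC.
  by rewrite (sum_roots _ _ quad quady xy).
have mk : k = m.
  apply/eqP; rewrite eqn_leq km /=.
  have : (m.*2 %| k + k)%N by rewrite -ox -iter_eq_order // iterD -/y -/z xz.
  by move=> /dvdn_leq; rewrite addnn double_gt0 leq_double; apply.
have sxy := sum_roots _ _ quad quady xy.
have pxy : x * y = - al * iota (c 0).
  have -> : y = al * iota (c 1) - x by rewrite -sxy; ring.
  by rewrite mulrBr -expr2 quad; ring.
have y0 : y != 0.
  by apply: contraNneq xy => y0; rewrite y0 (itI k x 0) // -/y y0 iter_fix ?rmorph0.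
have c0 : iota (c 0) != 0.
  by apply: contraTneq (mulf_neq0 x0 y0) => e; rewrite pxy e mulr0 eqxx.
exists (- (c 1 / c 0)); rewrite -mk -/y rmorphN fmorph_div /=.
rewrite addrC -[LHS](mulfK (mulf_neq0 x0 y0)) mulrDl mulrCA mulVf // mulr1.
rewrite mulKf // sxy pxy invfM invrN mulrACA.
by rewrite mulrN mulfV // mulN1r.
Qed.

(** With [y = phi^m x], the element [al = - x y] is fixed by [phi^m], so its degree over [F] is at
    most [m] and it can be an eigenvalue of some [A]. The values [c0 = 1], [c1 = - a] make
    [x ^ 2 = al * (c0 + c1 x)]. *)
Lemma inv_trace_tsr2_root (x : L) a :
    order phi x = m.*2 -> x^-1 + (iter m phi x)^-1 = iota a ->
  exists (c : {ffun 'I_2 -> F}) (A : 'M[F]_m), root (map_poly iota (char_poly (tsr_mx c A))) x.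
Proof.
move=> ox Ea; have fI := frob_inj (iota := iota).
have x0 : x != 0.
  by apply: order_frob_gt1_neq0; rewrite ox -addnn ltn_addl.
set y := iter m phi x in Ea.
have itI j : injective (iter j phi) by elim: j => // j IH u z /= /fI /IH.
have itM j u z : iter j phi (u * z) = iter j phi u * iter j phi z.
  by elim: j => //= j ->; rewrite rmorphM.
have y0 : y != 0.
  apply: contraNneq x0 => y0; apply/eqP/(itI m); rewrite -/y y0.
  by rewrite iter_fix ?rmorph0.
have yx : iter m phi y = x.
  by apply/eqP; rewrite /y -iterD addnn iter_eq_order // ox.
pose al := - (x * y).
have ma : (order phi al %| m)%N.
  rewrite -iter_eq_order // /al -mulN1r itM itM yx -/y mulrC [y * x]mulrC mulrC.
  by rewrite iter_fix // rmorphN rmorph1.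
have [Q [Qm _ sQ Qr]] := minimal_poly_frob iota al.
(* The power of [X] only raises the degree of the minimal polynomial of [al] to [m]. *)
have [||A EA] := @exists_char_poly F m (Q * 'X^(m - order phi al)).
- by rewrite monicMr ?monicXn.
- rewrite size_Mmonic ?monicXn // ?monic_neq0 // size_polyXn sQ addnS /=.
  by rewrite addSn subnKC // dvdn_leq // ltnW.
exists [ffun i => if i == 0 then 1 else - a], A.
apply/root_char_poly_tsr2; rewrite !ffunE /=.
have /eigenvalueP[v Ev v0] : eigenvalue (map_mx iota A) al.
  by rewrite eigenvalue_root_char -map_char_poly EA rmorphM rootM Qr.
exists v => //; rewrite Ev scalerA rmorphN rmorph1 -Ea /al; congr (_ *: _).
by field; rewrite x0 y0.
Qed.

Lemma mem_PsiI_tsr2 (P : {poly F}) (x : L) :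
    P \is monic -> irreducible_poly P -> size P = m.*2.+1 ->
    root (map_poly iota P) x ->
  P \in PsiI (TSRI F m 2) <-> exists a, x^-1 + (iter m phi x)^-1 = iota a.
Proof.
move=> Pm Pi Ps Px.
have ox : order phi x = m.*2.
  by apply: succn_inj; rewrite -(size_irreducible_root Pi Px).
split=> [/imfsetP[T /= /setIdP[/imset2P[c A _ _ ->] _] EP]|[a Ea]].
  by apply: (tsr2_root_inv_trace ox (c := c) (A := A)); rewrite -EP.
have [c [A rT]] := inv_trace_tsr2_root ox Ea.
have E : P = char_poly (tsr_mx c A).
  apply/eqP; rewrite -eqp_monic ?char_poly_monic // -dvdp_size_eqp.
    by rewrite Ps size_char_poly sum_nat_const card_ord mul2n.
  exact: irreducible_dvd_common_root Pi Px rT.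
apply/imfsetP; exists (tsr_mx c A) => //=.
rewrite inE imset2_f //=; apply/irreducibleP; by rewrite -E.
Qed.

Lemma PsiI_tsr2_spec (P : {poly F}) : P \in PsiI (TSRI F m 2) ->
  [/\ P \is monic, irreducible_poly P & size P = m.*2.+1].
Proof.
move=> /imfsetP[T /=]; rewrite inE => /andP[_ /irreducibleP Ti] ->.
split=> //; first exact: char_poly_monic.
by rewrite size_char_poly sum_nat_const card_ord mul2n.
Qed.

End RootCriterion.

(** * Counting roots in the splitting field *)

(** Induction on [j], writing [X^(Q^(j+1)) - X] as [((X^(Q^j))^Q - X^Q) + (X^Q - X)]; the first
    summand is a multiple of [X^(Q^j) - X]. *)
Lemma dvdp_Xexp_subX (R : idomainType) (q a b : nat) : (a %| b)%N ->
  ('X^(q ^ a) - 'X : {poly R}) %| 'X^(q ^ b) - 'X.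
Proof.
case/dvdnP=> j ->; rewrite mulnC expnM; set Q := (q ^ a)%N.
elim: j => [|j IH]; first by rewrite expn0 expr1 subrr dvdp0.
rewrite -(subrK 'X^Q 'X^(Q ^ j.+1)) -addrA dvdp_add //.
by rewrite expnSr exprM subrXX dvdp_mulr.
Qed.

Lemma order_semiconj (T : finType) (f h : T -> T) x :
  injective f -> injective h -> (forall y, f (h y) = h (f y)) ->
  order f (h x) = order f x.
Proof.
move=> fI hI fh.
have it k : iter k f (h x) = h (iter k f x) by elim: k => //= k ->.
apply/eqP; rewrite eqn_dvd -!iter_eq_order //.
by rewrite it iter_order // eqxx -(inj_eq hI) -it iter_order //=.
Qed.

Section SplitField.

Variables (F L : finFieldType) (iota : {rmorphism F -> L}) (m : nat).
Variable s : seq L.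
Hypotheses (m_gt1 : (1 < m)%N) (s_uniq : uniq s).
Hypothesis Xq_split : 'X^(#|F| ^ m.*2) - 'X = \prod_(z <- s) ('X - z%:P).
Local Notation phi := (frob iota).

Lemma card_roots_dvd_Xq (p : {poly L}) :
  p %| 'X^(#|F| ^ m.*2) - 'X -> #|[set x | root p x]| = (size p).-1.
Proof.
rewrite Xq_split => /dvdp_prod_XsubC[msk Ep].
rewrite (eqp_size Ep) size_prod_XsubC /=.
rewrite -(card_uniqP (mask_uniq s_uniq msk)); apply: eq_card => x.
by rewrite inE (eqp_root Ep) root_prod_XsubC.
Qed.

(** The solutions are the roots of [h = X^Q + X - a]. Since [h^Q - h = X^(Q^2) - X], this [h]
    divides the split polynomial and has [Q] distinct roots in [L]. *)
Lemma card_frob_reflect k a : (k %| m)%N ->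
  #|[set x | iter k phi x == iota a - x]| = (#|F| ^ k)%N.
Proof.
move=> km; have k2 : (k.*2 %| m.*2)%N by rewrite -!mul2n dvdn_pmul2l.
set Q := (#|F| ^ k)%N.
have [k0|k_gt0] := posnP k; first by move: km m_gt1; rewrite k0 dvd0n => /eqP ->.
have Q1 : (1 < Q)%N by rewrite -(exp1n k) ltn_exp2r // finNzRing_gt1.
pose h : {poly L} := 'X^Q + ('X - (iota a)%:P).
have sh : size h = Q.+1.
  by rewrite size_polyDl size_polyXn // size_XsubC.
have Qch : [pchar {poly L}].-nat Q.
  rewrite (eq_pnat _ (pchar_lalg _)) (eq_pnat _ (fmorph_pchar iota)).
  by rewrite /Q pnatX card_finField_pnat.
have hh : h ^+ Q - h = 'X^(#|F| ^ k.*2) - 'X.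
  rewrite {1}/h !exprDn_pchar // -exprM mulnn /Q -expnM muln2.
  rewrite -polyCN -polyC_exp -rmorphN -(iter_frob iota).
  rewrite (_ : iter k phi _ = iota (- a)); last first.
    by elim: (k) => //= j ->; rewrite frob_iota.
  by rewrite /h rmorphN polyCN -/Q; ring.
have hd : h %| 'X^(#|F| ^ m.*2) - 'X.
  apply: dvdp_trans (dvdp_Xexp_subX _ _ k2); rewrite -hh dvdp_subl // dvdp_exp //.
  exact: ltnW.
rewrite -[RHS]/(Q.+1.-1) -sh -(card_roots_dvd_Xq hd); apply: eq_card => x.
by rewrite !inE iter_frob /h rootE !hornerE -[LHS]subr_eq0 opprB addrA.
Qed.

(** By [mem_PsiI_tsr2], these are the roots in [L] of the polynomials in [PsiI (TSRI F m 2)]. *)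
Definition inv_trace_set : {set L} :=
  [set x | (order phi x == m.*2) && [exists a, x^-1 + (iter m phi x)^-1 == iota a]].

(** Double counting of pairs of a polynomial and a root: each polynomial has [2 m] distinct roots in
    [L], and each [x] is a root of exactly one, its minimal polynomial. *)
Lemma card_PsiI_tsr2 : (#|` PsiI (TSRI F m 2)| * m.*2)%N = #|inv_trace_set|.
Proof.
transitivity (\sum_(x in inv_trace_set)
   \sum_(P <- PsiI (TSRI F m 2)) (root (map_poly iota P) x : nat))%N; last first.
  rewrite -sum1_card; apply: eq_bigr => x; rewrite inE => /andP[/eqP ox].
  case/existsP=> a /eqP Ea.
  have [P [Pm Pi sP Px]] := minimal_poly_frob iota x; rewrite ox in sP.
  have PP : P \in PsiI (TSRI F m 2).
    by apply/(mem_PsiI_tsr2 m_gt1 Pm Pi sP Px); exists a.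
  rewrite (bigD1_seq P) ?fset_uniq //= Px big_seq_cond big1 // => Q /andP[QP nQP].
  apply/eqP; rewrite eqb0; apply: contra nQP => Qx.
  have [Qm Qi _] := PsiI_tsr2_spec QP.
  rewrite -eqp_monic //; apply/andP.
  by split; [exact: irreducible_dvd_common_root Qi Qx Px
            |exact: irreducible_dvd_common_root Pi Px Qx].
rewrite exchange_big /= [RHS]big_seq.
rewrite [RHS](eq_bigr (fun=> m.*2)) => [|P PP].
  by rewrite -[RHS]big_seq [RHS]big_const_seq count_predT iter_addn_0 mulnC.
have [Pm Pi sP] := PsiI_tsr2_spec PP.
rewrite -[RHS]/(m.*2.+1.-1) -sP -(size_map_poly iota).
have Pd : map_poly iota P %| 'X^(#|F| ^ m.*2) - 'X.
  have := irreducible_dvd_Xq Pi; rewrite sP -(dvdp_map iota) rmorphB /=.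
  by rewrite map_polyXn map_polyX.
rewrite -(card_roots_dvd_Xq Pd) -sum1_card big_mkcond [RHS]big_mkcond /=.
apply: eq_bigr => x _; rewrite !inE; case: (boolP (root _ x)) => [Px|_]; last by case: ifP.
have -> : order phi x == m.*2 by rewrite -eqSS -(size_irreducible_root Pi Px) sP.
have /(mem_PsiI_tsr2 m_gt1 Pm Pi sP Px)[a Ea] := PP.
by case: existsP => //= -[]; exists a; rewrite Ea.
Qed.

Definition reflect_set (a : F) : {set L} :=
  [set x | (iter m phi x == iota a - x) && (order phi x == m.*2)].

Let phiI : injective phi := @frob_inj _ _ iota.

Let iterD k x y : iter k phi (x + y) = iter k phi x + iter k phi y.
Proof. by elim: k => //= k ->; rewrite rmorphD. Qed.

Let iterM k x y : iter k phi (x * y) = iter k phi x * iter k phi y.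
Proof. by elim: k => //= k ->; rewrite rmorphM. Qed.

Let iterV k x : iter k phi x^-1 = (iter k phi x)^-1.
Proof. by elim: k => //= k ->; rewrite fmorphV. Qed.

Let iterF k a : iter k phi (iota a) = iota a.
Proof. by elim: k => //= k ->; rewrite frob_iota. Qed.

(** If [x^-1] has trace [a] under [1 + phi^m], then [x^-1 - a / 2] is negated by [phi^m].
    Translation by an element of [F] and inversion commute with [phi], so orders are kept. *)
Lemma card_inv_trace_set_odd : 2%:R != 0 :> F ->
  #|inv_trace_set| = (#|F| * #|reflect_set 0%R|)%N.
Proof.
move=> two0; pose h (u : F * L) := (iota u.1 + u.2)^-1.
rewrite -cardsT -cardsX -(card_in_imset (f := h)); last first.
  move=> [a x] [b y] /setXP[_ /setIdP[/eqP Ex _]] /setXP[_ /setIdP[/eqP Ey _]].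
  rewrite /h /= => /invr_inj E.
  (* Adding the image under [phi^m] cancels the negated parts and leaves [2 a = 2 b]. *)
  have := congr1 (fun z => z + iter m phi z) E.
  rewrite !iterD !iterF Ex Ey rmorph0 !sub0r.
  have dbl (u v : L) : u + v + (u - v) = u *+ 2 by ring.
  rewrite !dbl -!rmorphMn => /fmorph_inj /= E2.
  have ab : a = b.
    by apply: (mulIf two0); rewrite !mulr_natr.
  by move: E; rewrite ab => /addrI ->.
have ord_h a x : order phi (h (a, x)) = order phi x.
  apply: (order_semiconj (h := fun x => h (a, x))) => //.
    by move=> y z /invr_inj/addrI.
  by move=> y; rewrite /h /= fmorphV rmorphD /= frob_iota.
apply: eq_card => x; apply/idP/imsetP => [|[[a d] /setXP[_ /setIdP[/eqP Ed od]] ->]].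
  rewrite inE => /andP[ox /existsP[a /eqP Ea]].
  have Ex : x = h (a / 2%:R, x^-1 - iota (a / 2%:R)).
    by rewrite /h /= addrC subrK invrK.
  exists (a / 2%:R, x^-1 - iota (a / 2%:R)) => //.
  rewrite inE inE /= inE -(ord_h (a / 2%:R)) -Ex ox andbT.
  have -> : iter m phi (x^-1 - iota (a / 2)) = iter m phi x^-1 - iota (a / 2).
    by rewrite -rmorphN iterD iterF rmorphN.
  rewrite iterV rmorph0 sub0r opprB subr_eq addrAC -mulr2n -subr_eq0.
  rewrite opprB addrA [_ + x^-1]addrC Ea -rmorphMn /= -mulr_natr divfK //.
  by rewrite subrr.
rewrite inE ord_h od /=; apply/existsP; exists (a *+ 2).
rewrite -iterV /h invrK iterD iterF Ed rmorph0 sub0r.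
by rewrite addrACA subrr addr0 rmorphMn.
Qed.

(** Halving is impossible in characteristic 2, so [x^-1] is divided by its trace [a] instead, giving
    an element of trace 1. *)
Lemma card_inv_trace_set_even : 2%:R = 0 :> F ->
  #|inv_trace_set| = (#|F|.-1 * #|reflect_set 1%R|)%N.
Proof.
move=> two0; have Nid (x : L) : - x = x.
  apply/eqP; rewrite eq_sym -subr_eq0 opprK -mulr2n -mulr_natr.
  by rewrite -(rmorph_nat iota) two0 rmorph0 mulr0.
pose h (u : F * L) := (iota u.1 * u.2)^-1.
have h_ord a x : a != 0 -> order phi (h (a, x)) = order phi x.
  move=> a0; apply: (order_semiconj (h := fun x => h (a, x))) => //.
    by move=> y z /invr_inj/mulfI; apply; rewrite fmorph_eq0.
  by move=> y; rewrite /h /= fmorphV rmorphM /= frob_iota.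
rewrite -(cardC1 (0 : F)) -cardX -(card_in_imset (f := h)); last first.
  move=> [a x] [b y] /andP[/= a0 /setIdP[/eqP Ex _]].
  move=> /andP[/= b0 /setIdP[/eqP Ey _]].
  rewrite /h /= => /invr_inj E.
  have := congr1 (fun z => z + iter m phi z) E.
  have dbl (u v : L) : u * v + u * (1 - v) = u by ring.
  rewrite !iterM !iterF Ex Ey rmorph1 !dbl => /fmorph_inj ab; move: E; rewrite ab => /mulfI -> //.
  by rewrite fmorph_eq0.
apply: eq_card => x; apply/idP/imsetP => [|[[a d] /andP[/= a0 /setIdP[/eqP Ed od]] ->]].
  rewrite inE => /andP[/eqP ox /existsP[a /eqP Ea]].
  (* In characteristic 2, trace 0 means that [phi^m] fixes [x], against the order [2 m]. *)
  have a0 : a != 0.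
    apply: contra_eqN ox => /eqP a0; rewrite a0 rmorph0 -iterV in Ea.
    have : iter m phi x^-1 == x^-1 by rewrite -[X in _ == X]Nid -addr_eq0 addrC Ea.
    rewrite iterV (inj_eq invr_inj) iter_eq_order // => /dvdn_leq.
    move=> /(_ (ltnW m_gt1)); rewrite leqNgt; apply: contra => /eqP ->.
    by rewrite -addnn -{1}[m]addn0 ltn_add2l ltnW.
  have ia0 : iota a != 0 by rewrite fmorph_eq0.
  have Ex : x = h (a, x^-1 / iota a) by rewrite /h /= mulrC divfK // invrK.
  exists (a, x^-1 / iota a) => //.
  rewrite inE /= inE /= inE a0 -(h_ord a) // -Ex ox eqxx andbT /=.
  rewrite -fmorphV iterM iterF iterV fmorphV rmorph1.
  by rewrite eq_sym subr_eq -mulrDl addrC Ea divff.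
rewrite inE h_ord // od /=; apply/existsP; exists a.
by rewrite -iterV /h invrK iterM iterF Ed rmorph1 mulrBr mulr1 addrC subrK.
Qed.

Lemma card_reflect_set a :
  #|reflect_set a|%:Z = \sum_(d <- divisors m | odd d)
    mobius d * #|[set x | (iter (m %/ d) phi x == iota a - x)
                       && (iota a - x != x)]|%:Z.
Proof.
apply: (card_order_twice_mobius (tau := fun x => iota a - x)) => //.
- by move=> x; rewrite opprB addrC subrK.
- by move=> x; rewrite rmorphB /= frob_iota.
exact: ltnW.
Qed.

Lemma card_reflect_set0 : 2%:R != 0 :> F ->
  #|reflect_set 0|%:Z = \sum_(d <- divisors m | odd d)
    mobius d * ((#|F| ^ (m %/ d))%:Z - 1).
Proof.
move=> two0; rewrite card_reflect_set big_seq_cond [RHS]big_seq_cond.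
apply: eq_bigr => d /andP[]; rewrite -dvdn_divisors ?(ltnW m_gt1) // => dm _.
congr (_ * _); rewrite -(card_frob_reflect 0 (dvdn_div dm)).
(* For odd [q], 0 is the only fixed point of [x |-> - x]; excluding it accounts for the [- 1] in
   each term. *)
have fix0 : iter (m %/ d) phi 0 == iota 0 - 0.
  by rewrite -{1}(rmorph0 iota) iterF subr0.
rewrite [in RHS](cardsD1 0) inE fix0 addnC PoszD addrK.
congr (Posz _); apply: eq_card => x.
rewrite !inE rmorph0 sub0r andbC; congr (_ && _).
rewrite eq_sym -subr_eq0 opprK -mulr2n -mulr_natr mulf_eq0 negb_or.
by rewrite -(rmorph_nat iota) fmorph_eq0 two0 andbT.
Qed.

Lemma card_reflect_set1 : 2%:R = 0 :> F ->
  #|reflect_set 1|%:Z = \sum_(d <- divisors m | odd d)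
    mobius d * (#|F| ^ (m %/ d))%:Z.
Proof.
move=> two0; rewrite card_reflect_set big_seq_cond [RHS]big_seq_cond.
apply: eq_bigr => d /andP[]; rewrite -dvdn_divisors ?(ltnW m_gt1) // => dm _.
congr (_ * _); rewrite -(card_frob_reflect 1 (dvdn_div dm)).
congr (Posz _); apply: eq_card => x; rewrite !inE rmorph1.
(* In characteristic 2, [1 - x = x] would give [1 = 2 x = 0], so no solution is excluded. *)
rewrite [X in _ && X](_ : _ = true) ?andbT //.
rewrite subr_eq -mulr2n -mulr_natr -(rmorph_nat iota) two0 rmorph0 mulr0.
exact: oner_neq0.
Qed.

End SplitField.

(** * Parity of [q], odd divisors of [m] and the three cases *)

Lemma odd_card_finField (F : finFieldType) : odd #|F| = (2%:R != 0 :> F).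
Proof.
have [p pp pF] := finPcharP F.
have := finNzRing_gt1 F; rewrite (card_pprimeChar pF).
case: (logn _ _) => // k _; rewrite oddX /=.
rewrite -(dvdn_pcharf pF) dvdn_prime2 //.
by case: (even_prime pp) => [->|op]; rewrite // op; case: eqP op => // ->.
Qed.

Lemma perm_odd_divisors (l k : nat) : odd k ->
  perm_eq [seq d <- divisors (2 ^ l * k) | odd d] (divisors k).
Proof.
move=> ok; have k0 : (0 < k)%N by case: k ok.
apply: uniq_perm; rewrite ?filter_uniq ?divisors_uniq // => d.
rewrite mem_filter -!dvdn_divisors // ?muln_gt0 ?expn_gt0 //.
apply/andP/idP => [[od]|dk]; first by rewrite Gauss_dvdr // coprimeXr ?coprimen2.
by rewrite (dvdn_odd dk) // dvdn_mull.
Qed.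

Lemma card_PsiI_tsr2_odd (F : finFieldType) (m : nat) : (1 < m)%N -> odd #|F| ->
  (#|` PsiI (TSRI F m 2)| * m.*2)%:Z =
  #|F|%:Z * \sum_(d <- divisors m | odd d) mobius d * ((#|F| ^ (m %/ d))%:Z - 1).
Proof.
move=> m1 oF; rewrite odd_card_finField in oF.
have m0 : (0 < m.*2)%N by rewrite double_gt0 ltnW.
have [L [iota [s [us Xs]]]] := exists_splitting_Xq F m0.
rewrite (card_PsiI_tsr2 iota m1 us Xs) card_inv_trace_set_odd // PoszM.
by rewrite (card_reflect_set0 iota m1 us Xs).
Qed.

Lemma card_PsiI_tsr2_even (F : finFieldType) (m : nat) : (1 < m)%N -> ~~ odd #|F| ->
  (#|` PsiI (TSRI F m 2)| * m.*2)%:Z =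
  (#|F|%:Z - 1) * \sum_(d <- divisors m | odd d) mobius d * (#|F| ^ (m %/ d))%:Z.
Proof.
rewrite odd_card_finField negbK => m1 /eqP two0.
have m0 : (0 < m.*2)%N by rewrite double_gt0 ltnW.
have [L [iota [s [us Xs]]]] := exists_splitting_Xq F m0.
rewrite (card_PsiI_tsr2 iota m1 us Xs) (card_inv_trace_set_even iota m1) // PoszM.
rewrite (card_reflect_set1 iota m1 us Xs) // -subn1 subzn //.
exact: ltnW (finNzRing_gt1 F).
Qed.

Theorem theorem3p4 (F : finFieldType) (q m : nat)
    (hq : #|F| = q) (hm : (1 < m)%N) :
  let N : rat := #|` PsiI (TSRI F m 2)|%:R in
  let S : rat :=
    \sum_(d <- divisors m | odd d) (mobius d)%:~R * q%:R ^+ (m %/ d)%N in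
  let case1 := odd q /\ exists l : nat, m = (2 ^ l)%N in
  let case2 := odd q /\
    exists l k : nat, [/\ m = (2 ^ l * k)%N, (3 <= k)%N & odd k] in
  [/\ case1 -> N = q%:R / (2 * m)%:R * (q%:R ^+ m - 1),
      case2 -> N = q%:R / (2 * m)%:R * S
    & ~ case1 -> ~ case2 -> N = (q%:R - 1) / (2 * m)%:R * S].
Proof.
move=> N S case1 case2.
have m2 : (2 * m)%:R != 0 :> rat.
  by rewrite Num.Theory.pnatr_eq0 mul2n double_eq0 -lt0n ltnW.
have SE : S = (\sum_(d <- divisors m | odd d) mobius d * (q ^ (m %/ d))%:Z)%:~R.
  rewrite rmorph_sum; apply: eq_bigr => d _.
  by rewrite rmorphM /= -pmulrn natrX.
(* The subtracted sum of [mobius] over the odd divisors of [m] is what separates the two odd cases: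
   it is 1 when [m] is a power of 2 and 0 otherwise. *)
have oddN : odd q -> N * (2 * m)%:R =
    q%:R * (S - (\sum_(d <- divisors m | odd d) mobius d)%:~R).
  move=> oq; rewrite -natrM mul2n pmulrn card_PsiI_tsr2_odd ?hq // rmorphM /=.
  rewrite -pmulrn SE -rmorphB -sumrB; congr (_ * _%:~R).
  by apply: eq_bigr => d _; rewrite mulrBr mulr1.
split=> [[oq [l Em]]|[oq [l [k [Em k3 ok]]]]|n1 n2].
- have /(perm_big _) sum1 : perm_eq [seq d <- divisors m | odd d] (divisors 1).
    by have := @perm_odd_divisors l 1 isT; rewrite muln1 -Em.
  rewrite mulrAC; apply: (canRL (mulfK m2)); rewrite oddN //; congr (_ * (_ - _)).
    by rewrite /S -big_filter sum1 /= big_seq1 divn1 mul1r.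
  by rewrite -big_filter sum1 /= big_seq1.
- rewrite mulrAC; apply: (canRL (mulfK m2)); rewrite oddN //; congr (_ * _).
  rewrite [in X in _ - X]Em -big_filter (perm_big _ (perm_odd_divisors l ok)).
  rewrite sum_mobius_divisors; last by case: (k) k3.
  by rewrite (gtn_eqF (ltn_trans _ k3)) // subr0.
(* For odd [q] the first two cases are exhaustive: the odd part [k] of [m] is either 1 or at least
   3. *)
have eq : ~~ odd q.
  apply/negP => oq; have [l [k [ok Em]]] : exists l k, odd k /\ m = (2 ^ l * k)%N.
    by have [k ok Em] := pfactor_coprime (isT : prime 2) (ltnW hm);
       exists (logn 2 m), k; rewrite mulnC -coprime2n.
  have [k3|k3] := leqP 3 k; first by case: n2; split=> //; exists l, k.
  case: n1; split=> //; exists l; rewrite Em.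
  by case: k ok k3 {Em} => [|[|[|]]] //; rewrite muln1.
rewrite mulrAC; apply: (canRL (mulfK m2)).
rewrite -natrM mul2n pmulrn card_PsiI_tsr2_even ?hq // rmorphM /= rmorphB /=.
by rewrite -pmulrn -SE.
Qed.
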